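(* Assume that for every $j\in\{1,\dots,n\}$ one has $q_{mj}=0$ for all $m\in\{0,\dots,n\}$ with $m\neq j$, and that there is at least one $j\in\{1,\dots,n\}$ with $q_{j0}>0$. Let $\tilde A\in\mathbb R^{n\times(k+2)}$ be the matrix whose $i$-th row ($1\le i\le n$) is $$\Big(a_i^T\ \Big|\ q_{i0}+\tfrac12\|a_i\|^2\ \Big|\ 1\Big).$$ Then at every $\phi\in(0,\infty)^n$, $$\dim\operatorname{Lie}\{D_0^J,D_1,\dots,D_k\}(\phi)=\min\{\operatorname{rank}(\tilde A),\,n\}.$$
   Context: Let $1\le k<n$ be integers. Let $Q=(q_{ij})_{i,j=0}^n$ be a real matrix with $q_{ij}\ge0$ for $i\ne j$, $q_{ii}\le0$, and $\sum_{j=0}^nq_{ij}=0$ for every $i$. Let $\lambda_0,\dots,\lambda_n\in\mathbb R^k$ be pairwise distinct, with $\lambda_0$ a vertex of their convex hull. Put $a_i:=\lambda_i-\lambda_0\in\mathbb R^k$ (a column vector), with components $a_{ir}$ ($1\le r\le k$), and $\Sigma_{ij}:=a_i\cdot a_j$. For $\phi\in(0,\infty)^n$ let $\phi_0:=1$ and $y(\phi):=1+\sum_{i=1}^n\phi_i$. Define vector fields on $(0,\infty)^n$: $$D_r=\sum_{j=1}^na_{jr}\phi_j\,\partial_{\phi_j}\ (1\le r\le k),\qquad D_0=\sum_{j=1}^n\Big(\frac1{y(\phi)}\sum_{i=1}^n\Sigma_{ij}\phi_i\phi_j-\frac12\|a_j\|^2\phi_j\Big)\partial_{\phi_j},$$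 $$J=\sum_{j=1}^n\sum_{i=0}^n(q_{ij}-q_{i0}\phi_j)\phi_i\,\partial_{\phi_j},\qquad D_0^J=D_0+J.$$ Lie bracket: $[F,G]=FG-GF$. $\operatorname{Lie}\{D_0^J,D_1,\dots,D_k\}(\phi)\subset\mathbb R^n$ denotes the linear span of the values at $\phi$ of the fields $D_0^J,D_1,\dots,D_k$ and of all their iterated Lie brackets. *)

(* Defs.v *)
From HB Require Import structures.
From mathcomp Require Export all_boot all_order all_algebra.
From mathcomp Require Export boolp classical_sets reals topology normedtype derive.

Set Implicit Arguments.
Unset Strict Implicit.
Unset Printing Implicit Defensive.

Import Order.TTheory GRing.Theory Num.Theory.
Import numFieldNormedType.Exports.

Local Open Scope classical_set_scope.
Local Open Scope ring_scope.

Definition conv_hull (R : realType) (k m : nat) (p : 'I_m -> 'cV[R]_k) :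
    set 'cV[R]_k :=
  [set x | exists w : 'I_m -> R,
    [/\ forall i, 0 <= w i, \sum_i w i = 1 & x = \sum_i w i *: p i]].

Definition is_vertex (R : realType) (k : nat) (C : set 'cV[R]_k) (v : 'cV[R]_k)
    : Prop :=
  C v /\ forall x y (t : R), C x -> C y -> 0 < t < 1 ->
    v = t *: x + (1 - t) *: y -> x = v /\ y = v.

(* The Euclidean product; the library norm on matrices is the sup norm, so
   ||a||^2 is written [dot a a]. *)
Definition dot (R : realType) (k : nat) (u v : 'cV[R]_k) : R :=
  \sum_(r < k) u r 0 * v r 0.

(* [F] stands for the field sum_j (F phi)_j d/dphi_j. Fields are total
   functions on R^n; at a point of the open orthant, derivatives and brackets
   do not depend on the values outside the orthant. *)
Definition vfield (R : realType) (n : nat) := 'rV[R]_n -> 'rV[R]_n.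

Definition vf_apply (R : realType) (n : nat) (F : vfield R n)
    (g : 'rV[R]_n -> R) : 'rV[R]_n -> R :=
  fun phi => \sum_(i < n) F phi 0 i * 'D_(delta_mx 0 i : 'rV[R]_n) g phi.

(* The j-th coefficient of FG - GF is its value on the j-th coordinate
   function, that is F(G_j) - G(F_j). *)
Definition lie_bracket (R : realType) (n : nat) (F G : vfield R n) :
    vfield R n :=
  fun phi => \row_(j < n) (vf_apply F (fun x => G x 0 j) phi
                           - vf_apply G (fun x => F x 0 j) phi).

Inductive iter_bracket (R : realType) (n : nat) (S : set (vfield R n)) :
    vfield R n -> Prop :=
| iter_bracket_gen F : S F -> iter_bracket S F
| iter_bracket_br F G : iter_bracket S F -> iter_bracket S G ->
    iter_bracket S (lie_bracket F G).

Definition lin_span (R : realType) (V : vectType R) (S : set V) : set V :=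
  [set v | exists2 s : seq V, (forall x, x \in s -> S x) & v \in <<s>>%VS].

Definition has_dim (R : realType) (V : vectType R) (E : set V) (d : nat) :
    Prop :=
  exists2 U : {vspace V}, E = [set v | v \in U] & \dim U = d.

Definition Lie (R : realType) (n : nat) (S : set (vfield R n))
    (phi : 'rV[R]_n) : set 'rV[R]_n :=
  lin_span [set F phi | F in iter_bracket S].

(* Indices 0, ..., n are elements of 'I_n.+1; the element j of 'I_n encodes the
   index j + 1 of {1, ..., n}, that is [ix j]. *)
Notation ix j := (lift ord0 j).

Definition ext (R : realType) (n : nat) (phi : 'rV[R]_n) (i : 'I_n.+1) : R :=
  if unlift ord0 i is Some j then phi 0 j else 1.

Definition ysum (R : realType) (n : nat) (phi : 'rV[R]_n) : R :=
  1 + \sum_(i < n) phi 0 i.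

Definition avec (R : realType) (k n : nat) (lam : 'I_n.+1 -> 'cV[R]_k)
    (i : 'I_n.+1) : 'cV[R]_k :=
  lam i - lam ord0.

Definition fieldD (R : realType) (k n : nat) (lam : 'I_n.+1 -> 'cV[R]_k)
    (r : 'I_k) : vfield R n :=
  fun phi => \row_(j < n) (avec lam (ix j) r 0 * phi 0 j).

Definition fieldD0 (R : realType) (k n : nat) (lam : 'I_n.+1 -> 'cV[R]_k) :
    vfield R n :=
  fun phi => \row_(j < n)
    ((ysum phi)^-1 *
       (\sum_(i < n) dot (avec lam (ix i)) (avec lam (ix j))
                     * phi 0 i * phi 0 j)
     - 2^-1 * dot (avec lam (ix j)) (avec lam (ix j)) * phi 0 j).

Definition fieldJ (R : realType) (n : nat) (q : 'M[R]_n.+1) : vfield R n :=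
  fun phi => \row_(j < n)
    \sum_(i < n.+1) (q i (ix j) - q i ord0 * phi 0 j) * ext phi i.

Definition fieldD0J (R : realType) (k n : nat) (lam : 'I_n.+1 -> 'cV[R]_k)
    (q : 'M[R]_n.+1) : vfield R n :=
  fun phi => fieldD0 lam phi + fieldJ q phi.

Definition generators (R : realType) (k n : nat) (lam : 'I_n.+1 -> 'cV[R]_k)
    (q : 'M[R]_n.+1) : set (vfield R n) :=
  [set fieldD0J lam q] `|` range (fieldD lam).

Definition Atilde (R : realType) (k n : nat) (lam : 'I_n.+1 -> 'cV[R]_k)
    (q : 'M[R]_n.+1) : 'M[R]_(n, k + 2) :=
  \matrix_(i < n)
    row_mx (avec lam (ix i))^T
      (row_mx (q (ix i) ord0
                + 2^-1 * dot (avec lam (ix i)) (avec lam (ix i)))%:M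
              (1%:M : 'M[R]_1)).

(* Main.v *)
(* In the coordinates ln phi_j the field D_r is the constant vector given by
   column r of Atilde, and D_0^J is a combination, with rational coefficients,
   of the columns of Atilde: the m_r := (1/y) sum_i a_ir phi_i on the first k,
   -1 on the column b := q_i0 + |a_i|^2/2, and -s with s := sum_i q_i0 phi_i on
   the column 1.  Brackets of such combinations only differentiate the
   coefficients, so every iterated bracket stays in the column space.
   Conversely [D_r, D_0^J] has coefficient 0 on b and
   -sum_i q_i0 a_ir phi_i on 1.  If the latter vanished for all r, then lambda_0
   would be a convex combination of the lambda_i with q_i0 > 0, contradicting
   that it is a vertex; hence the span contains the column 1, and then b. *)
Require Import Defs.
From mathcomp Require Import ring functions.

Set Implicit Arguments.
Unset Strict Implicit.
Unset Printing Implicit Defensive.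

Import Order.TTheory GRing.Theory Num.Theory.
Import numFieldNormedType.Exports.

Local Open Scope ring_scope.
Local Open Scope classical_set_scope.

(** * Rational functions with powers of [ysum] as denominators, and their partial derivatives *)

Section RationalFunctions.
Variables (R : realType) (n : nat).
Implicit Types (x : 'rV[R]_n) (f g : 'rV[R]_n -> R).

Definition orthant x := forall i, 0 < x 0 i.

Lemma near_orthant x : orthant x -> \near x, orthant x.
Proof.
move=> x_gt0; near=> y => i; move: i; near: y; apply: filter_forall => i.
exact: (@coord_continuous R 1 n 0 i x _ (lt_nbhsr (x_gt0 i))).
Unshelve. all: by end_near. Qed.

Lemma is_derive_coord x v i : is_derive x v (fun y => y 0 i) (v 0 i).
Proof.
have := (@derivable_mxP R 'rV[R]_n 1 n id x v).1 (@derivable_id _ _ x v) 0 i.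
move=> D; apply: DeriveDef => //.
by rewrite -[in RHS](derive_id x v) derive_mx ?mxE//; apply: derivable_id.
Qed.

Lemma is_derive_sum_fun m (h : 'I_m -> 'rV[R]_n -> R) (dh : 'I_m -> R) x v :
  (forall i, is_derive x v (h i) (dh i)) ->
  is_derive x v (fun y => \sum_i h i y) (\sum_i dh i).
Proof. by move=> hdh; rewrite -fct_sumE; apply: is_derive_sum. Qed.

Lemma ysum_gt0 x : orthant x -> 0 < ysum x.
Proof.
by move=> x_gt0; apply: ltr_wpDr => //; apply: sumr_ge0 => i _; apply: ltW.
Qed.

Lemma is_derive_ysum x i : is_derive x (delta_mx 0 i) (@ysum R n) 1.
Proof.
have Dsum : is_derive x (delta_mx 0 i) (fun y : 'rV[R]_n => \sum_j y 0 j)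
    (\sum_j (delta_mx 0 i : 'rV[R]_n) 0 j).
  by apply: is_derive_sum_fun => j; apply: is_derive_coord.
suff -> : 1 = 0 + \sum_j (delta_mx 0 i : 'rV[R]_n) 0 j.
  exact: (is_deriveD (is_derive_cst (1 : R) x (delta_mx 0 i)) Dsum).
rewrite add0r (bigD1 i)//= mxE !eqxx big1 ?addr0// => j ji.
by rewrite mxE (negPf ji) andbF.
Qed.

Inductive ratfun : ('rV[R]_n -> R) -> Prop :=
| ratfun_cst c : ratfun (fun=> c)
| ratfun_coord i : ratfun (fun x => x 0 i)
| ratfun_ysumV : ratfun (fun x => (ysum x)^-1)
| ratfunD f g : ratfun f -> ratfun g -> ratfun (fun x => f x + g x)
| ratfunM f g : ratfun f -> ratfun g -> ratfun (fun x => f x * g x).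

Lemma ratfunN f : ratfun f -> ratfun (fun x => - f x).
Proof.
by under eq_fun do rewrite -mulN1r; move=> ?; apply: ratfunM => //; apply: ratfun_cst.
Qed.

Lemma ratfun_sum (I : finType) (F : I -> 'rV[R]_n -> R) :
  (forall i, ratfun (F i)) -> ratfun (fun x => \sum_i F i x).
Proof.
move=> Frat; elim: (index_enum I) => [|i s IHs].
  under eq_fun do rewrite big_nil; exact: ratfun_cst.
by under eq_fun do rewrite big_cons; apply: ratfunD.
Qed.

Lemma ratfun_is_derive f (i : 'I_n) : ratfun f ->
  exists2 df, ratfun df &
    forall x, orthant x -> is_derive x (delta_mx 0 i) f (df x).
Proof.
elim=> [c|j||{}f g _ [df dfr fdf] _ [dg dgr gdg]|{}f g fr [df dfr fdf] gr [dg dgr gdg]].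
- exists (fun=> 0); first exact: ratfun_cst.
  by move=> x _; apply: is_derive_cst.
- exists (fun=> (delta_mx 0 i : 'rV[R]_n) 0 j); first exact: ratfun_cst.
  by move=> x _; apply: is_derive_coord.
- exists (fun x => - ((ysum x)^-1 * (ysum x)^-1)).
    by apply: ratfunN; apply: ratfunM; apply: ratfun_ysumV.
  move=> x x_gt0; have y0 : ysum x != 0 by rewrite gt_eqF// ysum_gt0.
  have [dy Dy] := is_derive_ysum x i.
  apply: DeriveDef; first exact: derivableV.
  by rewrite deriveV// Dy scaler1 -exprVn expr2.
- exists (fun x => df x + dg x); first exact: ratfunD.
  by move=> x x0; apply: is_deriveD; [apply: fdf|apply: gdg].
- exists (fun x => f x * dg x + g x * df x).
    by apply: ratfunD; apply: ratfunM.
  by move=> x x0; apply: is_deriveM; [apply: fdf|apply: gdg].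
Qed.

(** Choosing the derivatives as functions, uniformly in the point, makes the coefficients of a
    bracket functions that can be differentiated again. *)
Lemma ratfun_partials (I : Type) (h : I -> 'rV[R]_n -> R) :
  (forall p, ratfun (h p)) ->
  exists2 dh : I -> 'I_n -> 'rV[R]_n -> R, forall p i, ratfun (dh p i) &
    forall p i x, orthant x -> is_derive x (delta_mx 0 i) (h p) (dh p i x).
Proof.
move=> hrat.
have /choice[dh dhP] (pi : I * 'I_n) : exists dh, ratfun dh /\
    forall x, orthant x -> is_derive x (delta_mx 0 pi.2) (h pi.1) (dh x).
  by have [dh] := ratfun_is_derive pi.2 (hrat pi.1); exists dh.
by exists (fun p i => dh (p, i)) => p i; have [] := dhP (p, i).
Qed.

End RationalFunctions.

(** * Vector fields expanded in a frame that is constant in logarithmic coordinates *)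

Section Frame.
Variables (R : realType) (n m : nat) (A : 'M[R]_(n, m)).
Implicit Types (x : 'rV[R]_n) (F G : vfield R n) (f g : 'I_m -> 'rV[R]_n -> R).

(* In the coordinates [ln x_j] this is the field with value [A *m f x]. *)
Definition log_frame f : vfield R n :=
  fun x => \row_j (x 0 j * \sum_p A j p * f p x).

(** Product rule. The first summand, from differentiating the factor [x 0 j], is symmetric in [f]
    and [g] when [F] is [log_frame f], so it cancels in a bracket. *)
Lemma vf_apply_log_frame F g (dg : 'I_m -> 'I_n -> R) x j :
  (forall p i, is_derive x (delta_mx 0 i) (g p) (dg p i)) ->
  vf_apply F (fun y => log_frame g y 0 j) x =
    F x 0 j * \sum_p A j p * g p x +
    x 0 j * \sum_p A j p * \sum_i F x 0 i * dg p i.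
Proof.
move=> g_dg; rewrite /vf_apply.
have D i : 'D_(delta_mx 0 i : 'rV[R]_n) (fun y => log_frame g y 0 j) x =
    x 0 j * (\sum_p A j p * dg p i) + (\sum_p A j p * g p x) * (i == j)%:R.
  under eq_fun do rewrite mxE.
  apply: derive_val; apply: is_derive_eq.
    apply: is_deriveM; first exact: is_derive_coord.
    by apply: is_derive_sum_fun => p; apply: is_deriveZ.
  by rewrite mxE eqxx eq_sym.
under eq_bigr do rewrite D mulrDr.
rewrite big_split/= addrC; congr (_ + _).
  rewrite (bigD1 j)//= eqxx mulr1 [X in _ + X]big1 ?addr0// => i /negPf ->.
  by rewrite !mulr0.
under eq_bigr do rewrite mulrCA.
rewrite -mulr_sumr; congr (_ * _).
under eq_bigr do rewrite mulr_sumr.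
rewrite exchange_big/=; apply: eq_bigr => p _.
by rewrite mulr_sumr; apply: eq_bigr => i _; rewrite mulrCA.
Qed.

(* In the coordinates [ln x_j] the columns of [A] are constant vectors, so a
   bracket only differentiates the coefficients. *)
Lemma lie_bracket_log_frame F G f g (df dg : 'I_m -> 'I_n -> R) x :
  orthant x ->
  (forall y, orthant y -> F y = log_frame f y) ->
  (forall y, orthant y -> G y = log_frame g y) ->
  (forall p i, is_derive x (delta_mx 0 i) (f p) (df p i)) ->
  (forall p i, is_derive x (delta_mx 0 i) (g p) (dg p i)) ->
  lie_bracket F G x = log_frame (fun p y =>
    \sum_i log_frame f y 0 i * dg p i - \sum_i log_frame g y 0 i * df p i) x.
Proof.
move=> x0 FE GE fdf gdg; apply/rowP => j; rewrite !mxE.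
(* The frame formulas hold only on the orthant; since it is open, they still determine the
   derivatives at [x]. *)
have near_frame H h : (forall y, orthant y -> H y = log_frame h y) ->
    \near x, H x 0 j = log_frame h x 0 j.
  by move=> HE; near=> y; rewrite HE//; near: y; apply: near_orthant.
have -> : vf_apply F (fun y => G y 0 j) x =
    vf_apply (log_frame f) (fun y => log_frame g y 0 j) x.
  apply: eq_bigr => i _; rewrite FE//; congr (_ * _).
  by apply: near_eq_derive; apply: near_frame.
have -> : vf_apply G (fun y => F y 0 j) x =
    vf_apply (log_frame g) (fun y => log_frame f y 0 j) x.
  apply: eq_bigr => i _; rewrite GE//; congr (_ * _).
  by apply: near_eq_derive; apply: near_frame.
rewrite (vf_apply_log_frame _ _ fdf) (vf_apply_log_frame _ _ gdg).
under [X in _ = _ * X]eq_bigr do rewrite mulrBr.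
rewrite sumrB !mxE; ring.
Unshelve. all: by end_near.
Qed.

Lemma iter_bracket_log_frame (S : set (vfield R n)) F :
  (forall G, S G -> exists2 g, forall p, ratfun (g p) &
    forall x, orthant x -> G x = log_frame g x) ->
  iter_bracket S F -> exists2 f, forall p, ratfun (f p) &
    forall x, orthant x -> F x = log_frame f x.
Proof.
move=> Sframe; elim=> [G /Sframe//|{}F G _ [f frat FE] _ [g grat GE]].
have [df dfrat fdf] := ratfun_partials frat.
have [dg dgrat gdg] := ratfun_partials grat.
have frame_rat h i : (forall p, ratfun (h p)) ->
    ratfun (fun x => log_frame h x 0 i).
  move=> hrat; under eq_fun do rewrite mxE.
  apply: ratfunM; first exact: ratfun_coord.
  by apply: ratfun_sum => p; apply: ratfunM => //; apply: ratfun_cst.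
exists (fun p x => \sum_i log_frame f x 0 i * dg p i x -
                   \sum_i log_frame g x 0 i * df p i x).
  move=> p; apply: ratfunD; last apply: ratfunN;
    by apply: ratfun_sum => i; apply: ratfunM => //; apply: frame_rat.
move=> x x0; rewrite (lie_bracket_log_frame x0 FE GE (fun p i => fdf p i x x0)
  (fun p i => gdg p i x x0)).
by apply/rowP => j; rewrite !mxE.
Qed.

End Frame.

(** * Row spaces as subspaces, and nonnegative combinations at a vertex *)

(** Links matrix rank to [has_dim]: the rows of [row_base W] are free and span the row space of
    [W]. *)
Lemma rowspace_vspace (R : fieldType) (m n : nat) (W : 'M[R]_(m, n)) :
  exists2 U : {vspace 'rV[R]_n}, (forall v, (v \in U) = (v <= W)%MS) &
    \dim U = \rank W.
Proof.
pose X := [tuple row i (row_base W) | i < \rank W].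
have XE (c : 'I_(\rank W) -> R) : \sum_i c i *: X`_i = (\row_i c i) *m row_base W.
  rewrite mulmx_sum_row; apply: eq_bigr => i _.
  by rewrite mxE -tnth_nth tnth_mktuple.
exists <<X>>%VS; last first.
  apply/eqP; rewrite -[X in _ == X](size_tuple X).
  apply/freeP => c; rewrite XE => /eqP.
  rewrite mulmx_free_eq0 ?row_base_free// => /eqP/rowP c0 i.
  by have := c0 i; rewrite !mxE.
move=> v; transitivity (v <= row_base W)%MS; last by rewrite eq_row_base.
apply/idP/idP => [vX|/submxP[u ->]].
  by rewrite (coord_span vX) XE submxMl.
rewrite mulmx_sum_row; apply: memv_suml => i _; apply: memvZ.
by apply: memv_span; apply/tnthP; exists i; rewrite tnth_mktuple.
Qed.

(** Rescaling [w] to mass 1/2 and putting the other half on [lam ord0] writes this vertex as a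
    convex combination of all the points. Splitting off a [j] of positive weight [t] makes it a
    proper combination of [lam (ix j)] and another hull point, so [lam (ix j) = lam ord0], against
    injectivity. *)
Lemma vertex_combination_eq0 (R : realType) (k n : nat)
    (lam : 'I_n.+1 -> 'cV[R]_k) (w : 'I_n -> R) :
  injective lam -> is_vertex (conv_hull lam) (lam ord0) ->
  (forall i, 0 <= w i) -> \sum_i w i *: avec lam (ix i) = 0 ->
  forall j, w j = 0.
Proof.
move=> lam_inj [_ lam0P] w_ge0 w_comb j; apply/eqP/negP => /negP wj0.
have wj_gt0 : 0 < w j by rewrite lt_def wj0 w_ge0.
pose W := \sum_i w i.
have W_gt0 : 0 < W.
  by rewrite /W (bigD1 j)//=; apply: ltr_wpDr => //; apply: sumr_ge0.
(* Half of the mass is kept on [lam ord0], so that the weight [t] of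
   [lam (ix j)] stays below 1 even if [w] is concentrated at [j]. *)
pose u i := w i / (2 * W).
have u_ge0 i : 0 <= u i by rewrite divr_ge0// mulr_ge0// ltW.
have u_sum : \sum_i u i = 2^-1.
  by rewrite -mulr_suml -/W; field; rewrite gt_eqF.
have u_comb : \sum_i u i *: lam (ix i) = 2^-1 *: lam ord0.
  rewrite -u_sum scaler_suml; apply/eqP; rewrite -subr_eq0 -sumrB; apply/eqP.
  transitivity ((2 * W)^-1 *: \sum_i w i *: avec lam (ix i)).
    rewrite scaler_sumr.
    by apply: eq_bigr => i _; rewrite scalerA scalerBr mulrC.
  by rewrite w_comb scaler0.
pose t := u j.
have t_gt0 : 0 < t by rewrite divr_gt0// mulr_gt0.
have u_sum' : \sum_(i | i != j) u i = 2^-1 - t.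
  by rewrite -u_sum [in RHS](bigD1 j)//= [RHS]addrC addKr.
have t_lt1 : t < 1.
  have : 0 <= 2^-1 - t by rewrite -u_sum' sumr_ge0.
  by rewrite subr_ge0 => /le_lt_trans -> //; rewrite invf_lt1// ltr1n.
have t1_gt0 : 0 < 1 - t by rewrite subr_gt0.
(* Weights left after removing the mass [t] at [ix j], renormalized to total 1. *)
pose v i := (1 - t)^-1 *
  (if unlift ord0 i is Some l then if l == j then 0 else u l else 2^-1).
have vlift l : v (ix l) = (1 - t)^-1 * (if l == j then 0 else u l).
  by rewrite /v liftK.
have v0 : v ord0 = (1 - t)^-1 * 2^-1 by rewrite /v unlift_none.
have hull_j : conv_hull lam (lam (ix j)).
  exists (fun i => (i == ix j)%:R); split => //.
    by rewrite (bigD1 (ix j))//= eqxx big1 ?addr0// => i /negPf ->.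
  rewrite (bigD1 (ix j))//= eqxx scale1r big1 ?addr0// => i /negPf ->.
  by rewrite scale0r.
have hull_v : conv_hull lam (\sum_i v i *: lam i).
  exists v; split=> // [i|].
    rewrite mulr_ge0 ?invr_ge0 ?(ltW t1_gt0)//.
    by case: unliftP => [l _|_]; [case: ifP|rewrite invr_ge0].
  rewrite big_ord_recl v0; under eq_bigr do rewrite vlift.
  rewrite -mulr_sumr -mulrDr (bigD1 j)//= eqxx add0r.
  under eq_bigr => i /negPf -> do [].
  by rewrite u_sum'; field; rewrite gt_eqF.
have lam0E : lam ord0 = t *: lam (ix j) + (1 - t) *: \sum_i v i *: lam i.
  have vE : (1 - t) *: \sum_i v i *: lam i =
      2^-1 *: lam ord0 + \sum_(i | i != j) u i *: lam (ix i).
    rewrite big_ord_recl v0 scalerDr scalerA mulrA divff ?gt_eqF// mul1r.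
    rewrite scaler_sumr (bigD1 j)//= vlift eqxx mulr0 scale0r scaler0 add0r.
    congr (_ + _); apply: eq_bigr => i /negPf ij.
    by rewrite vlift ij scalerA mulrA divff ?gt_eqF// mul1r.
  move: u_comb; rewrite vE addrCA (bigD1 j)//= -/t => ->.
  by rewrite -scalerDl (_ : 2^-1 + 2^-1 = 1 :> R) ?scale1r//; field.
have t01 : 0 < t < 1 by rewrite t_gt0.
by have [/lam_inj/eqP] := lam0P _ _ _ hull_j hull_v t01 lam0E.
Qed.

(** * The generators in the frame of the columns of [Atilde] *)

Section Generators.
Variables (R : realType) (k n : nat) (q : 'M[R]_n.+1).
Variable lam : 'I_n.+1 -> 'cV[R]_k.
Hypothesis q_sum : forall i, \sum_j q i j = 0.
Hypothesis q_col : forall (j : 'I_n) (m : 'I_n.+1), m != ix j -> q m (ix j) = 0.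

Let A := Atilde lam q.
Let pa (r : 'I_k) : 'I_(k + 2) := lshift 2 r.
Let pb : 'I_(k + 2) := rshift k (ord0 : 'I_2).
Let p1 : 'I_(k + 2) := rshift k (ord_max : 'I_2).

Lemma big_Atilde_cols (V : nmodType) (h : 'I_(k + 2) -> V) :
  \sum_p h p = \sum_r h (pa r) + h pb + h p1.
Proof.
rewrite big_split_ord/= big_ord_recl big_ord1 addrA.
by congr (_ + _ + h (rshift _ _)); apply/val_inj.
Qed.

Lemma Atilde_pa j r : A j (pa r) = avec lam (ix j) r 0.
Proof. by rewrite mxE row_mxEl mxE. Qed.

Lemma Atilde_pb j :
  A j pb = q (ix j) ord0 + 2^-1 * dot (avec lam (ix j)) (avec lam (ix j)).
Proof.
have -> : pb = rshift k (lshift 1 (ord0 : 'I_1)) by apply/val_inj.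
by rewrite mxE row_mxEr row_mxEl mxE eqxx.
Qed.

Lemma Atilde_p1 j : A j p1 = 1.
Proof.
have -> : p1 = rshift k (rshift 1 (ord0 : 'I_1)) by apply/val_inj.
by rewrite mxE row_mxEr row_mxEr mxE eqxx.
Qed.

Lemma fieldD_log_frame r :
  fieldD lam r = log_frame A (fun p _ => (p == pa r)%:R).
Proof.
apply/funext => x; apply/rowP => j; rewrite mxE [RHS]mxE (bigD1 (pa r))//=.
rewrite eqxx mulr1 big1 ?addr0 => [|p /negPf ->]; last by rewrite mulr0.
by rewrite Atilde_pa mulrC.
Qed.

(** The column hypothesis leaves only q_j0 and q_jj in row j, so zero row sums give q_jj = -q_j0 and
    q_00 = 0. The factor x_j then comes out, and J fits into the logarithmic frame. *)
Lemma fieldJE x j : fieldJ q x 0 j =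
  x 0 j * (- q (ix j) ord0 - \sum_i q (ix i) ord0 * x 0 i).
Proof.
have q00 : q ord0 ord0 = 0.
  rewrite -(q_sum ord0) big_ord_recl big1 ?addr0// => i _.
  by rewrite q_col// neq_lift.
have qjj : q (ix j) (ix j) = - q (ix j) ord0.
  apply/eqP; rewrite -addr_eq0 -(q_sum (ix j)) (bigD1 (ix j))//=.
  rewrite (bigD1 ord0) ?neq_lift//= [X in _ == _ + (_ + X)]big1 ?addr0//.
  move=> i /andP[]; case: (unliftP ord0 i) => [l ->|->]; last by rewrite eqxx.
  by rewrite eq_sym => + _; apply: q_col.
rewrite mxE big_ord_recl q00 q_col ?neq_lift// mul0r subr0 mul0r add0r.
under eq_bigr => i _ do rewrite /ext liftK mulrBl.
rewrite sumrB (bigD1 j)//= big1 => [|i ij]; last first.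
  by rewrite q_col ?mul0r// (inj_eq lift_inj).
rewrite qjj addr0 mulrBr mulrC; congr (_ - _).
by rewrite mulr_sumr; apply: eq_bigr => i _; rewrite mulrAC mulrC mulrA.
Qed.

Definition coefD0J (p : 'I_(k + 2)) (x : 'rV[R]_n) : R :=
  match fintype.split p with
  | inl r => (ysum x)^-1 * \sum_i avec lam (ix i) r 0 * x 0 i
  | inr e => if e == ord0 then -1 else - \sum_i q (ix i) ord0 * x 0 i
  end.

Lemma coefD0J_pa r x :
  coefD0J (pa r) x = (ysum x)^-1 * \sum_i avec lam (ix i) r 0 * x 0 i.
Proof. by rewrite /coefD0J (unsplitK (inl r)). Qed.

Lemma coefD0J_pb x : coefD0J pb x = -1.
Proof. by rewrite /coefD0J (unsplitK (inr _)). Qed.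

Lemma coefD0J_p1 x : coefD0J p1 x = - \sum_i q (ix i) ord0 * x 0 i.
Proof. by rewrite /coefD0J (unsplitK (inr _)). Qed.

Lemma ratfun_coefD0J p : ratfun (coefD0J p).
Proof.
have lin (c : 'I_n -> R) : ratfun (fun x => \sum_i c i * x 0 i).
  apply: ratfun_sum => i; apply: ratfunM; first exact: ratfun_cst.
  exact: ratfun_coord.
rewrite /coefD0J; case: fintype.split => [r|e].
  by apply: ratfunM; [apply: ratfun_ysumV|apply: lin].
by case: (e == ord0); [apply: ratfun_cst|apply: ratfunN; apply: lin].
Qed.

(** Expanding the dot products and exchanging sums gives the coefficients m_r. The column b gets -1
    because it gathers the terms -|a_j|^2/2 of D_0 and -q_j0 of J. *)
Lemma fieldD0J_log_frame : fieldD0J lam q = log_frame A coefD0J.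
Proof.
apply/funext => x; apply/rowP => j; rewrite mxE fieldJE mxE [RHS]mxE.
rewrite big_Atilde_cols Atilde_pb Atilde_p1 coefD0J_pb coefD0J_p1.
under [in RHS]eq_bigr do rewrite Atilde_pa coefD0J_pa mulrCA.
rewrite -mulr_sumr.
have -> : \sum_i dot (avec lam (ix i)) (avec lam (ix j)) * x 0 i * x 0 j =
    x 0 j * \sum_r avec lam (ix j) r 0 * \sum_i avec lam (ix i) r 0 * x 0 i.
  rewrite mulr_sumr; under [RHS]eq_bigr do rewrite !mulr_sumr.
  rewrite exchange_big/=; apply: eq_bigr => i _.
  rewrite /dot !mulr_suml; apply: eq_bigr => r _; ring.
ring.
Qed.

(** The sum is, up to sign, the derivative of [coefD0J p1] along D_r. The vertex lemma is applied to
    the weights [q (ix i) ord0 * x 0 i]. *)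
Lemma exists_derive_coefD0J_p1 x :
  (forall i j, i != j -> 0 <= q i j) -> injective lam ->
  is_vertex (conv_hull lam) (lam ord0) -> (exists j, 0 < q (ix j) ord0) ->
  orthant x ->
  exists r, \sum_i avec lam (ix i) r 0 * x 0 i * q (ix i) ord0 != 0.
Proof.
move=> q_off lam_inj lam0 [j qj] x0; apply: contrapT => /forallNP Dr0.
have : q (ix j) ord0 * x 0 j = 0.
  apply: (vertex_combination_eq0 (w := fun i => q (ix i) ord0 * x 0 i)
    lam_inj lam0) => [i|].
    by rewrite mulr_ge0 ?q_off ?ltW.
  apply/colP => r; rewrite summxE [RHS]mxE.
  have /negP/negPn/eqP Dr := Dr0 r; rewrite -[RHS]Dr.
  by apply: eq_bigr => i _; rewrite mxE; ring.
by apply/eqP; rewrite mulf_neq0// gt_eqF//.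
Qed.

(** Returning to the original coordinates multiplies entry j of a frame vector by [x 0 j]; the
    transpose turns frame vectors into rows. The diagonal factor is invertible on the orthant, so
    the rank is that of [Atilde]. *)
Definition Atilde_rows (x : 'rV[R]_n) := A^T *m diag_mx x.

Lemma log_frameE f x :
  log_frame A f x = \sum_p f p x *: row p (Atilde_rows x).
Proof.
apply/rowP => j; rewrite mxE summxE mulr_sumr; apply: eq_bigr => p _.
rewrite 2![in RHS]mxE /Atilde_rows mul_mx_diag mxE [A^T _ _]mxE; ring.
Qed.

Lemma rank_Atilde_rows x : orthant x -> \rank (Atilde_rows x) = \rank A.
Proof.
move=> x0; rewrite -[RHS]mxrank_tr mxrankMfree// row_free_unit unitmxE.
by rewrite det_diag unitfE; apply/prodf_neq0 => i _; rewrite gt_eqF.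
Qed.

(** Brackets of two generators suffice: modulo the rows [pa r], the field [D_r, D_0^J] is a multiple
    of row [p1], nonzero for some r; then D_0^J yields row [pb]. *)
Lemma Atilde_rows_Lie x (U : {vspace 'rV[R]_n}) :
  (forall i j, i != j -> 0 <= q i j) -> injective lam ->
  is_vertex (conv_hull lam) (lam ord0) -> (exists j, 0 < q (ix j) ord0) ->
  orthant x ->
  (forall r, fieldD lam r x \in U) -> fieldD0J lam q x \in U ->
  (forall r, lie_bracket (fieldD lam r) (fieldD0J lam q) x \in U) ->
  forall p, row p (Atilde_rows x) \in U.
Proof.
move=> q_off lam_inj lam0 q_to0 x0 UD UD0 Ubr.
have Upa r : row (pa r) (Atilde_rows x) \in U.
  have := UD r; rewrite fieldD_log_frame log_frameE (bigD1 (pa r))//= eqxx.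
  by rewrite scale1r big1 ?addr0// => p /negPf ->; rewrite scale0r.
have Uframe f : (log_frame A f x \in U) = (f pb x *: row pb (Atilde_rows x) +
    f p1 x *: row p1 (Atilde_rows x) \in U).
  by rewrite log_frameE big_Atilde_cols -addrA rpredDl// rpred_sum// => r _;
    apply: memvZ.
have [dg _ gdg] := ratfun_partials ratfun_coefD0J.
have dgb i : dg pb i x = 0.
  have [_ <-] := gdg pb i x x0.
  rewrite (_ : coefD0J pb = cst (-1)) ?derive_cst//.
  by apply/funext => y; rewrite coefD0J_pb.
have dg1 i : dg p1 i x = - q (ix i) ord0.
  have [_ <-] := gdg p1 i x x0.
  rewrite (_ : coefD0J p1 = fun y => - \sum_i q (ix i) ord0 * y 0 i); last first.
    by apply/funext => y; rewrite coefD0J_p1.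
  apply: derive_val; apply: is_derive_eq.
    apply: is_deriveN; apply: is_derive_sum_fun => l; apply: is_deriveZ.
    exact: is_derive_coord.
  rewrite (bigD1 i)//= big1 => [|l li].
    by rewrite mxE !eqxx addr0 [_ *: _]mulr1.
  by rewrite mxE (negPf li) andbF scaler0.
have Up1 : row p1 (Atilde_rows x) \in U.
  have [r Dr] := exists_derive_coefD0J_p1 q_off lam_inj lam0 q_to0 x0.
  have := Ubr r.
  (* [df] is zero because D_r has constant coefficients in the frame. *)
  rewrite (lie_bracket_log_frame (A := A) (df := fun _ _ => 0) x0 (g := coefD0J)
    (f := fun p _ => (p == pa r)%:R) _ _ _ (fun p i => gdg p i x x0)).
  - rewrite Uframe -fieldD_log_frame.
    under eq_bigr do rewrite dgb mulr0.
    under [X in _ - X]eq_bigr do rewrite mulr0.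
    under [X in (X - _) *: row p1 _]eq_bigr do rewrite dg1 mxE mulrN.
    under [X in (_ - X) *: row p1 _]eq_bigr do rewrite mulr0.
    rewrite sumrN !big1_eq !subr0 scale0r add0r.
    (* The coefficient of row [p1] is [- d], hence the scalar [- d^-1]. *)
    move: Dr; set d := \sum_i _ => d0 /memvZ -/(_ (- d^-1)).
    by rewrite scalerA mulrNN mulVf// scale1r.
  - by move=> y _; rewrite fieldD_log_frame.
  - by move=> y _; rewrite fieldD0J_log_frame.
have Upb : row pb (Atilde_rows x) \in U.
  have := UD0; rewrite fieldD0J_log_frame Uframe coefD0J_pb.
  rewrite (rpredDr _ (memvZ _ Up1)).
  by rewrite scaleN1r memvN.
move=> p; case: (split_ordP p) => [r ->|]; first exact: Upa.
case; case=> [|[|//]] e_lt ->.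
  by rewrite (_ : Ordinal e_lt = ord0)//; apply/val_inj.
by rewrite (_ : Ordinal e_lt = ord_max)//; apply/val_inj.
Qed.

End Generators.

(** * The two inclusions between the Lie span and the row space of [Atilde_rows] *)

Theorem proposition4p10 (R : realType) (k n : nat) (hk : (1 <= k)%N)
  (hkn : (k < n)%N) (q : 'M[R]_n.+1)
  (q_off : forall i j, i != j -> 0 <= q i j)
  (q_diag : forall i, q i i <= 0)
  (q_sum : forall i, \sum_j q i j = 0)
  (lam : 'I_n.+1 -> 'cV[R]_k) (lam_inj : injective lam)
  (lam0_vertex : is_vertex (conv_hull lam) (lam ord0))
  (q_col : forall (j : 'I_n) (m : 'I_n.+1), m != ix j -> q m (ix j) = 0)
  (q_to0 : exists j : 'I_n, 0 < q (ix j) ord0)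
  (phi : 'rV[R]_n) (phi_gt0 : forall i, 0 < phi 0 i) :
  has_dim (Lie (generators lam q) phi) (minn (\rank (Atilde lam q)) n).
Proof.
(* [Atilde] has n rows, so the minimum is its rank. *)
rewrite (minn_idPl (rank_leq_row _)) -(rank_Atilde_rows q lam phi_gt0).
have [U UE <-] := rowspace_vspace (Atilde_rows q lam phi).
exists U => //; apply/seteqP; split=> v /=.
- case=> s sLie; apply: subvP; apply/span_subvP => _ /sLie[F FLie <-].
  have [|f _ ->//] := @iter_bracket_log_frame _ _ _ (Atilde lam q) _ F _ FLie.
    move=> G [->|[r _ <-]].
      exists (coefD0J q lam); first exact: ratfun_coefD0J.
      by move=> x _; rewrite fieldD0J_log_frame.
    exists (fun p _ => (p == lshift 2 r)%:R); first by move=> p; apply: ratfun_cst.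
    by move=> x _; rewrite (fieldD_log_frame q).
  rewrite log_frameE; apply: memv_suml => p _; apply: memvZ.
  by rewrite UE row_sub.
- rewrite UE => /submxP[u ->].
  pose br r := lie_bracket (fieldD lam r) (fieldD0J lam q) phi.
  exists (fieldD0J lam q phi :: [seq fieldD lam r phi | r : 'I_k] ++
          [seq br r | r : 'I_k]).
    have genD r : iter_bracket (generators lam q) (fieldD lam r).
      by apply: iter_bracket_gen; right; exists r.
    have genD0J : iter_bracket (generators lam q) (fieldD0J lam q).
      by apply: iter_bracket_gen; left.
    move=> x; rewrite inE mem_cat => /or3P[/eqP ->|/mapP[r _ ->]|/mapP[r _ ->]].
    + by exists (fieldD0J lam q).
    + by exists (fieldD lam r).
    + by exists (lie_bracket (fieldD lam r) (fieldD0J lam q)) => //;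
        apply: iter_bracket_br.
  rewrite mulmx_sum_row; apply: memv_suml => p _; apply: memvZ.
  apply: Atilde_rows_Lie => // [r||r]; apply: memv_span; rewrite inE mem_cat.
  + by rewrite (map_f (fun r => fieldD lam r phi)) ?mem_enum ?orbT.
  + by rewrite eqxx.
  + by rewrite (map_f br) ?mem_enum ?orbT.
Qed.
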